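(* (Decomposition Theorem) Let $G$ be a finite undirected graph and let $C=\{C_0,C_1,\dots,C_t\}$ be an ordered clique cover of $G$, with width $W(C)$. Then there are $W(C)$ unit incomparability graphs $H_1,H_2,\dots,H_{W(C)}$, each with vertex set $V(G)$, whose intersection is $G$, i.e. $E(G)=\bigcap_{i=1}^{W(C)}E(H_i)$. Moreover, $H_i$ is a co-bipartite graph (the complement of a bipartite graph) for $i=1,2,\dots,W(C)-1$, and the graphs $H_1,\dots,H_{W(C)}$ can be constructed in polynomial time.
   Context: A clique cover of $G$ is a set of pairwise vertex-disjoint cliques of $G$ such that every vertex of $G$ lies in exactly one of them; writing $C=\{C_0,\dots,C_t\}$ means the cliques are listed in this order. The width of the ordered clique cover $C$ is $W(C)=\max\{|j-i| : xy\in E(G),\ x\in C_i,\ y\in C_j\}$. The bandwidth $BW(H)$ of a graph $H$ is the minimum over all linear orderings $v_0,\dots,v_{n-1}$ of $V(H)$ of $\max_{v_iv_j\in E(H)}|j-i|$. For a clique cover $C$ of $H$, the clique cover graph $H(C)$ has vertex set $C$, with $X,Y\in C$ adjacent iff some $x\in X$, $y\in Y$ are adjacent in $H$. The clique cover width $CCW(H)$ is the minimum of $BW(H(C))$ over all clique covers $C$ of $H$. A comparability graph is the undirected graph underlying the directed graph of a strict partial order ($a\to b$ iff $a<b$); an incomparability graph is the complement of a comparability graph. A unit incomparability graph is a graph $H$ with $CCW(H)\le 1$ (such graphs are incomparability graphs).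
   Formalization: The width W(C) is assumed to be at least 1; for W(C)=0 the family of graphs is empty and the claim fails, e.g. for two disjoint nonempty cliques covered by themselves, since an empty intersection is not E(G). *)

(* Defs.v *)
From mathcomp Require Import all_boot all_order all_algebra.

Set Implicit Arguments.
Unset Strict Implicit.
Unset Printing Implicit Defensive.

(** * Finite simple graphs *)

Record sgraph (V : finType) := SGraph {
  edge :> rel V;
  edge_sym : symmetric edge;
  edge_irr : irreflexive edge }.

Section Graphs.

Variable V : finType.
Implicit Types (G : sgraph V) (A K X Y : {set V}) (P : {set {set V}}).

Definition compl_edge G : rel V := fun x y => (x != y) && ~~ G x y.

Fact compl_sym G : symmetric (compl_edge G).
Proof. by move=> x y; rewrite /compl_edge eq_sym edge_sym. Qed.

Fact compl_irr G : irreflexive (compl_edge G).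
Proof. by move=> x; rewrite /compl_edge eqxx. Qed.

Definition compl G : sgraph V := SGraph (compl_sym G) (compl_irr G).

Definition bipartite G : Prop :=
  exists A, forall x y, G x y -> (x \in A) != (y \in A).

Definition cobipartite G : Prop := bipartite (compl G).

Definition clique G K : bool :=
  [forall x in K, forall y in K, (x != y) ==> G x y].

(* [partition] requires the blocks, hence the cliques, to be nonempty. *)
Definition clique_cover G P : bool :=
  partition P [set: V] && [forall K in P, clique G K].

Definition linked G X Y : bool := [exists x in X, exists y in Y, G x y].

(* [uniq] excludes repeated cliques, so that the C_i are pairwise disjoint. *)
Definition ordered_clique_cover G (t : nat) (C : t.+1.-tuple {set V}) : bool :=
  uniq C && clique_cover G [set K in C].

(* The maximum over no edges is 0. *)
Definition width G (t : nat) (C : t.+1.-tuple {set V}) : nat :=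
  \max_(i < t.+1) \max_(j < t.+1 | linked G (tnth C i) (tnth C j)) `|j - i|.

(* No loops are put on the cliques: the graph is simple. *)
Definition cover_edge G P : rel {X : {set V} | X \in P} :=
  fun S T => (S != T) && linked G (val S) (val T).

Fact linked_sym G : symmetric (linked G).
Proof.
move=> X Y; apply/idP/idP => /'exists_andP[x [xX /'exists_andP[y [yY xy]]]];
  apply/'exists_andP; exists y; split=> //; apply/'exists_andP; exists x;
  by rewrite edge_sym.
Qed.

Fact cover_sym G P : symmetric (@cover_edge G P).
Proof. by move=> S T; rewrite /cover_edge eq_sym linked_sym. Qed.

Fact cover_irr G P : irreflexive (@cover_edge G P).
Proof. by move=> S; rewrite /cover_edge eqxx. Qed.

Definition cover_graph G P : sgraph {X : {set V} | X \in P} :=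
  SGraph (@cover_sym G P) (@cover_irr G P).

(* The ordering is v_0, ..., v_(n-1) with n = #|V|; the default value #|V| of
   the minimum exceeds the value of every ordering (for V empty both are 0). *)
Definition bandwidth G : nat :=
  \big[minn/#|V|]_(v : {ffun 'I_#|V| -> V} | injectiveb v)
    \max_(i < #|V|) \max_(j < #|V| | G (v i) (v j)) `|j - i|.

End Graphs.

(* Here too the default value is harmless: a clique cover P of G has at most
   #|V| elements, and the bandwidth of a graph is at most its order. *)
Definition ccw (V : finType) (G : sgraph V) : nat :=
  \big[minn/#|V|]_(P : {set {set V}} | clique_cover G P)
    bandwidth (cover_graph G P).

Definition unit_incomparability (V : finType) (G : sgraph V) : Prop :=
  ccw G <= 1.

(** * Polynomial time

   A random access machine with structured control.  The memory is indexed by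
   nat and initially 0; the input is a read-only sequence, the output a
   write-only one.  Every instruction and every test costs 1.  As there is no
   multiplication, one instruction lengthens the binary representation of the
   largest number in memory by at most one bit (or makes it as long as an
   input cell or a constant of the program), so that polynomial time for this
   unit cost is polynomial time on Turing machines. *)

Inductive program :=
  | Const (r c : nat)
  | Add (r a b : nat)
  | Sub (r a b : nat)
  | LoadAt (r a : nat)
  | StoreAt (a b : nat)
  | ReadAt (r a : nat)
  | Write (a : nat)
  | Seq (p q : program)
  | If (a : nat) (p q : program)
  | While (a : nat) (p : program).

Definition memory := nat -> nat.

Definition upd (m : memory) (r v : nat) : memory := [eta m with r |-> v].

(* [exec x p m o k m' o']: on input x, the program p, started with memory m
   and output o, halts after k steps with memory m' and output o'. *)
Inductive exec (x : seq nat) :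
  program -> memory -> seq nat -> nat -> memory -> seq nat -> Prop :=
  | ExecConst r c m o : exec x (Const r c) m o 1 (upd m r c) o
  | ExecAdd r a b m o : exec x (Add r a b) m o 1 (upd m r (m a + m b)) o
  | ExecSub r a b m o : exec x (Sub r a b) m o 1 (upd m r (m a - m b)) o
  | ExecLoad r a m o : exec x (LoadAt r a) m o 1 (upd m r (m (m a))) o
  | ExecStore a b m o : exec x (StoreAt a b) m o 1 (upd m (m a) (m b)) o
  | ExecRead r a m o : exec x (ReadAt r a) m o 1 (upd m r (nth 0 x (m a))) o
  | ExecWrite a m o : exec x (Write a) m o 1 m (rcons o (m a))
  | ExecSeq p q m o k m1 o1 l m2 o2 :
      exec x p m o k m1 o1 -> exec x q m1 o1 l m2 o2 ->
      exec x (Seq p q) m o (k + l) m2 o2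
  | ExecIfTrue a p q m o k m1 o1 :
      0 < m a -> exec x p m o k m1 o1 -> exec x (If a p q) m o k.+1 m1 o1
  | ExecIfFalse a p q m o k m1 o1 :
      m a = 0 -> exec x q m o k m1 o1 -> exec x (If a p q) m o k.+1 m1 o1
  | ExecWhileTrue a p m o k m1 o1 l m2 o2 :
      0 < m a -> exec x p m o k m1 o1 ->
      exec x (While a p) m1 o1 l m2 o2 ->
      exec x (While a p) m o (k + l).+1 m2 o2
  | ExecWhileFalse a p m o :
      m a = 0 -> exec x (While a p) m o 1 m o.

Definition computes_in_steps (p : program) (x y : seq nat) (k : nat) : Prop :=
  exists m, exec x p (fun=> 0) [::] k m y.

(* The time bound refers to the number of cells of the input; the bit length
   of the input is at least as large. *)
Definition computes_within (p : program) (f : {poly nat}) (x y : seq nat) :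
    Prop :=
  exists2 k, k <= f.[size x]%R & computes_in_steps p x y k.

(** * Encodings, the vertices being numbered in the order of [enum V] *)

(* The adjacency matrix, row by row. *)
Definition encode_graph (V : finType) (G : sgraph V) : seq nat :=
  [seq nat_of_bool (G x y) | x <- enum V, y <- enum V].

(* The order of G, its adjacency matrix, and for each vertex x the index i
   such that x lies in C_i. *)
Definition encode_input (V : finType) (G : sgraph V) (t : nat)
    (C : t.+1.-tuple {set V}) : seq nat :=
  #|V| :: encode_graph G
    ++ [seq find (fun K : {set V} => x \in K) C | x <- enum V].

Definition encode_graphs (V : finType) (w : nat) (H : 'I_w -> sgraph V) :
    seq nat :=
  flatten [seq encode_graph (H i) | i <- enum 'I_w].

(* Main.v *)
Require Import Defs.
From mathcomp Require Import all_boot all_order all_algebra.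
From mathcomp Require Import zify.

Set Implicit Arguments.
Unset Strict Implicit.
Unset Printing Implicit Defensive.

(* Write w = W(C) and let a vertex of C_a have quotient a / w and remainder
   a mod w.  Making every class of equal quotient a clique gives a unit
   incomparability graph, because an edge of G changes the quotient by at most
   one.  The nonedges of G lost in this way join vertices of equal quotient and
   distinct remainders, hence they cross one of the w - 1 bipartitions
   {remainder < j}, {remainder >= j} with 0 < j < w; making both sides of such
   a bipartition cliques gives a cobipartite graph.  A random access machine
   writes the adjacency matrices entry by entry, recomputing quotients and
   remainders by repeated subtraction, in O(n^4) steps. *)

(** * Merging the levels of a function into cliques *)

Lemma bigminn_leq (I : eqType) (r : seq I) (P : pred I) (F : I -> nat) a i :
  i \in r -> P i -> \big[minn/a]_(j <- r | P j) F j <= F i.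
Proof.
elim: r => // k r IHr; rewrite inE big_cons => /predU1P[<- -> | /IHr le_r /le_r].
  exact: geq_minl.
by case: (P k) => // /(leq_trans _)->//; apply: geq_minr.
Qed.

Lemma distn_subD (m n : nat) : `|m - n|%N = (m - n) + (n - m).
Proof. lia. Qed.

(** The values of [f] may have gaps, so vertices are ordered by rank, the number of vertices of
    smaller value. Ranks differ no more than values: the vertices counted in between have distinct
    values in the interval from [f x] to [f y]. *)
Lemma bandwidth_leq (V : finType) (G : sgraph V) (f : V -> nat) k :
    injective f -> (forall x y, G x y -> f y - f x <= k) ->
  bandwidth G <= k.
Proof.
move=> f_inj fk; pose B x := [set z | f z < f x].
have ltB x : #|B x| < #|V|.
  rewrite -cardsT; apply: proper_card; apply/properP.
  split; first exact: subsetT.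
  by exists x; rewrite ?inE // ltnn.
pose rank x := Ordinal (ltB x).
have rankB x y : f x <= f y -> #|B y| - #|B x| <= f y - f x.
  move=> le_xy; have sB : B x \subset B y.
    by apply/subsetP=> z; rewrite !inE => /leq_trans->.
  rewrite -(setIidPr sB) -cardsD cardE -(size_map f).
  rewrite -[X in _ <= X](size_iota (f x)); apply: uniq_leq_size.
    by rewrite map_inj_uniq ?enum_uniq.
  move=> _ /mapP[z + ->]; rewrite mem_enum !inE mem_iota -leqNgt.
  by rewrite subnKC.
have lt_rank x y : f x < f y -> #|B x| < #|B y|.
  move=> lt_xy; apply: proper_card; apply/properP; split.
    by apply/subsetP=> z; rewrite !inE => /ltn_trans->.
  by exists x; rewrite !inE // ltnn.
have rank_inj : injective rank.
  move=> x y /(congr1 val) /= eq_xy; apply: f_inj.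
  by case: (ltngtP (f x) (f y)) => // /lt_rank; rewrite eq_xy ltnn.
have [g rankK gK] : bijective rank.
  by apply: inj_card_bij rank_inj _; rewrite card_ord.
have v_inj : injectiveb [ffun i => g i].
  by apply/injectiveP=> i j; rewrite !ffunE => /(can_inj gK).
rewrite /bandwidth.
apply: leq_trans (bigminn_leq _ _ (mem_index_enum [ffun i => g i]) v_inj) _.
apply/bigmax_leqP=> i _; apply/bigmax_leqP=> j; rewrite !ffunE => Gij.
have [fij fji] : f (g j) - f (g i) <= k /\ f (g i) - f (g j) <= k.
  by split; apply: fk; rewrite // edge_sym.
have rE l : #|B (g l)| = l by rewrite -[RHS](congr1 val (gK l)).
case: (leqP (f (g i)) (f (g j))) => [le_ij | /ltnW le_ji].
  have := rankB _ _ le_ij; have : #|B (g i)| <= #|B (g j)|.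
    by apply: subset_leq_card; apply/subsetP=> z; rewrite !inE => /leq_trans->.
  rewrite !rE; lia.
have := rankB _ _ le_ji; have : #|B (g j)| <= #|B (g i)|.
  by apply: subset_leq_card; apply/subsetP=> z; rewrite !inE => /leq_trans->.
rewrite !rE; lia.
Qed.

Section MergeClasses.

Variables (V : finType) (G : sgraph V) (f : V -> nat).

Definition merge_edge : rel V := fun x y => (x != y) && (G x y || (f x == f y)).

Fact merge_sym : symmetric merge_edge.
Proof. by move=> x y; rewrite /merge_edge eq_sym edge_sym [f x == _]eq_sym. Qed.

Fact merge_irr : irreflexive merge_edge.
Proof. by move=> x; rewrite /merge_edge eqxx. Qed.

Definition merge : sgraph V := SGraph merge_sym merge_irr.

(** A nonedge joins distinct levels, hence level 0 to level 1, and this 2-colours the complement. *)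
Lemma merge_cobipartite : (forall x, f x <= 1) -> cobipartite merge.
Proof.
move=> f_le1; exists [set x | f x == 0] => x y /andP[neq_xy].
rewrite /= /merge_edge neq_xy negb_or !inE => /andP[_].
by move: (f_le1 x) (f_le1 y); case: (f x) (f y) => [|[|?]] [|[|?]].
Qed.

(** The level classes form a clique cover. Ordered by level they give bandwidth at most 1, as an
    edge between two different classes is an edge of [G]. *)
Lemma merge_unit_incomparability :
  (forall x y, G x y -> f y - f x <= 1) -> unit_incomparability merge.
Proof.
move=> fG; pose P := preim_partition f [set: V].
have partP : partition P [set: V] by apply: preim_partitionP.
have fP K : K \in P -> {in K &, forall x y, f x = f y}.
  case/imsetP=> z _ -> x y; rewrite !inE => /eqP<- /eqP<- //.
have coverP : clique_cover merge P.
  rewrite /clique_cover partP; apply/forall_inP=> K KP.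
  apply/forall_inP=> x xK; apply/forall_inP=> y yK; apply/implyP=> neq_xy.
  by rewrite /= /merge_edge neq_xy (fP K KP x y) ?eqxx ?orbT.
rewrite /unit_incomparability /ccw.
apply: leq_trans (bigminn_leq _ _ (mem_index_enum P) coverP) _.
(* On the nonempty block [S] the function [f] is constant, so the maximum is its value there and no
   representative has to be chosen. *)
pose F (S : {X : {set V} | X \in P}) := \max_(x in val S) f x.
have FE (S : {X : {set V} | X \in P}) x : x \in val S -> F S = f x.
  move=> xS; rewrite /F; apply/eqP; rewrite eqn_leq leq_bigmax_cond // andbT.
  by apply/bigmax_leqP=> y yS; rewrite (fP _ (valP S) y x).
have [_ _ n0P] := and3P partP.
have witness (S : {X : {set V} | X \in P}) : exists x, x \in val S.
  by apply/set0Pn; apply: contra n0P => /eqP <-; apply: valP.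
apply: (@bandwidth_leq _ _ F) => [S T | S T /andP[_]].
  have valE (U : {X : {set V} | X \in P}) : val U = [set x | f x == F U].
    have [x xU] := witness U; rewrite (FE _ _ xU); apply/setP=> y; rewrite inE.
    case/imsetP: (valP U) xU => z _ ->; rewrite !inE => /eqP->.
    exact: eq_sym.
  by move=> eqF; apply: val_inj; rewrite !valE eqF.
case/'exists_andP=> x [xS /'exists_andP[y [yT]]].
rewrite (FE _ _ xS) (FE _ _ yT) => /andP[_ /orP[/fG // | /eqP->]].
by rewrite subnn.
Qed.

End MergeClasses.

(** * The position of a vertex in the ordered clique cover *)

Section Index.

Variables (V : finType) (G : sgraph V) (t : nat) (C : t.+1.-tuple {set V}).

Definition cover_index (x : V) : nat := find (fun K : {set V} => x \in K) C.

Lemma width_leq : width G C <= t.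
Proof.
apply/bigmax_leqP=> i _; apply/bigmax_leqP=> j _.
have := ltn_ord i; have := ltn_ord j; lia.
Qed.

Hypothesis coverC : ordered_clique_cover G C.

Lemma cover_index_lt x : cover_index x < t.+1.
Proof.
have /andP[_ /andP[partC _]] := coverC.
rewrite -[X in _ < X](size_tuple C) -has_find; apply/hasP.
have : x \in cover [set K in C] by rewrite (cover_partition partC).
by case/bigcupP=> K; rewrite inE => KC xK; exists K.
Qed.

(** Two cliques containing [x] are the same block of the partition, and [uniq] then makes their
    positions equal. *)
Lemma cover_indexE x (i : 'I_t.+1) : (x \in tnth C i) = (cover_index x == i).
Proof.
have /andP[uC /andP[/and3P[_ trivC _] _]] := coverC.
have xi : x \in tnth C (Ordinal (cover_index_lt x)).
  rewrite (tnth_nth set0) /=.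
  apply: (@nth_find _ set0 (fun K : {set V} => x \in K)).
  by rewrite has_find size_tuple cover_index_lt.
apply/idP/eqP=> [xCi | Ei]; last first.
  by move: xi; congr (x \in tnth C _); apply: val_inj.
have eqC : tnth C i = tnth C (Ordinal (cover_index_lt x)).
  rewrite -(def_pblock trivC _ xCi) ?inE ?mem_tnth //.
  by rewrite -(def_pblock trivC _ xi) ?inE ?mem_tnth.
by move/(tuple_uniqP _ uC): eqC => ->.
Qed.

Lemma cover_index_clique x y :
  x != y -> cover_index x = cover_index y -> G x y.
Proof.
move=> neq_xy eq_xy; have /andP[_ /andP[_ /forall_inP cl]] := coverC.
have /cl/forall_inP clK : tnth C (Ordinal (cover_index_lt x)) \in [set K in C].
  by rewrite inE mem_tnth.
have /clK/forall_inP clx : x \in tnth C (Ordinal (cover_index_lt x)).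
  by rewrite cover_indexE.
have /clx/implyP : y \in tnth C (Ordinal (cover_index_lt x)).
  by rewrite cover_indexE /= eq_xy.
exact.
Qed.

(** The cliques are nonempty and disjoint. This bounds the indices and the width by the order of the
    graph, and provides a vertex. *)
Lemma cover_size : t.+1 <= #|V|.
Proof.
have /andP[uC /andP[partC _]] := coverC.
have /and3P[_ _ n0C] := partC.
have -> : t.+1 = #|[set K in C]| by rewrite cardsE (card_uniqP uC) size_tuple.
rewrite -[#|V|]cardsT (card_partition partC) -sum1_card.
by apply: leq_sum => K KC; rewrite card_gt0; apply: contraNneq n0C => <-.
Qed.

Lemma widthE :
  width G C = \max_x \max_(y | G x y) `|cover_index x - cover_index y|%N.
Proof.
apply/eqP; rewrite eqn_leq; apply/andP; split.
  apply/bigmax_leqP=> i _; apply/bigmax_leqP=> j.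
  case/'exists_andP=> x [xi /'exists_andP[y [yj Gxy]]].
  move: xi yj; rewrite !cover_indexE => /eqP<- /eqP<-; rewrite distnC.
  apply: leq_trans (leq_bigmax x).
  exact: (leq_bigmax_cond (F := fun y => `|cover_index x - cover_index y|%N)).
apply/bigmax_leqP=> x _; apply/bigmax_leqP=> y Gxy; rewrite distnC.
apply: leq_trans (leq_bigmax (Ordinal (cover_index_lt x))).
apply: (leq_bigmax_cond (F := fun j : 'I_t.+1 => `|j - cover_index x|%N)
         (Ordinal (cover_index_lt y))).
by apply/'exists_andP; exists x; split; [|apply/'exists_andP; exists y; split=> //];
  rewrite cover_indexE.
Qed.

Lemma cover_index_width x y :
  G x y -> `|cover_index x - cover_index y|%N <= width G C.
Proof.
move=> Gxy; rewrite widthE; apply: leq_trans (leq_bigmax x).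
exact: (leq_bigmax_cond (F := fun y => `|cover_index x - cover_index y|%N)).
Qed.

End Index.

(** * The decomposition *)

(** The comparison is coerced to 0 or 1, so that the bipartitions and the division into quotients
    are both given by level functions for [merge]. *)
Definition level (w j a : nat) : nat :=
  if j == 0 then a %/ w else (j <= a %% w).

Section Decomposition.

Variables (V : finType) (G : sgraph V) (t : nat) (C : t.+1.-tuple {set V}).
Hypothesis coverC : ordered_clique_cover G C.
Hypothesis width_gt0 : 0 < width G C.

Definition component (j : nat) : sgraph V :=
  merge G (fun x => level (width G C) j (cover_index C x)).

Lemma component_unit j : unit_incomparability (component j).
Proof.
apply: merge_unit_incomparability => x y /(cover_index_width coverC).
rewrite /level; case: eqP => // _; last by do 2 case: (j <= _).
rewrite distn_subD; set a := cover_index C x; set b := cover_index C y => le_w.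
(* The goal becomes [b < (a %/ w + 2) * w] for [w] the width, which follows from [b <= a + w] and
   [a < (a %/ w + 1) * w]. *)
rewrite leq_subLR addnC -[X in _ + X]muln1 -ltnS -addnS.
rewrite ltn_divLR //.
have := divn_eq a (width G C); have := ltn_pmod a width_gt0.
nia.
Qed.

Lemma component_cobipartite j : 0 < j -> cobipartite (component j).
Proof.
move=> j_gt0; apply: merge_cobipartite => x.
by rewrite /level -if_neg -lt0n j_gt0; case: (j <= _).
Qed.

(** A pair adjacent in all components but not in [G] would have equal levels throughout, so equal
    quotients and remainders, so equal indices, and would lie in one clique. *)
Lemma bigcap_component x y :
  G x y = [forall i : 'I_(width G C), component (width G C - i.+1) x y].
Proof.
apply/idP/forallP=> [Gxy i | all_xy].
  rewrite /= /merge_edge Gxy andbT; apply: contraTneq Gxy => ->.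
  by rewrite edge_irr.
(* Sending [i] to [width G C - i.+1] is an involution of the indices, so every level is reached. *)
have at_level j : j < width G C -> component j x y.
  move=> lt_j; have lt_i : width G C - j.+1 < width G C by lia.
  by have := all_xy (Ordinal lt_i); congr (component _ x y); rewrite /=; lia.
have /andP[neq_xy /orP[// | /eqP Eq]] := at_level 0 width_gt0.
apply: contraT => nGxy.
have eq_level j : j < width G C ->
    level (width G C) j (cover_index C x) =
    level (width G C) j (cover_index C y).
  by case/at_level/andP=> _; rewrite (negPf nGxy) => /eqP.
(* The threshold [u %% width G C] separates [u] from every [v] of smaller remainder; if it is 0, the
   inequality is trivial. *)
have le_mod u v : (forall j, j < width G C ->
    level (width G C) j u = level (width G C) j v) ->
    u %% width G C <= v %% width G C.
  move/(_ _ (ltn_pmod u width_gt0)); rewrite /level leqnn.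
  by case: posnP => [-> // | _]; case: (_ <= _).
suff Er : cover_index C x %% width G C = cover_index C y %% width G C.
  rewrite -(negPf nGxy) (cover_index_clique coverC neq_xy) //.
  move: Eq; rewrite /level eqxx => Eq.
  by rewrite (divn_eq (cover_index C x) (width G C)) Eq Er -divn_eq.
by apply/eqP; rewrite eqn_leq !le_mod // => j /eq_level.
Qed.

End Decomposition.

(** * Executing programs on sequences *)

Fixpoint loop_free (p : program) : bool :=
  match p with
  | Seq p q | If _ p q => loop_free p && loop_free q
  | While _ _ => false
  | _ => true
  end.

Fixpoint cost (p : program) : nat :=
  match p with
  | Seq p q => cost p + cost q
  | If _ p q => (maxn (cost p) (cost q)).+1
  | _ => 1
  end.

Local Notation Sub := Defs.Sub.

(* A sequence represents the memory that it lists, padded with zeros.  The value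
   on a program with loops is junk. *)
Fixpoint eval (x : seq nat) (p : program) (so : seq nat * seq nat) :
    seq nat * seq nat :=
  let: (s, o) := so in
  let rd r := nth 0 s r in
  match p with
  | Const r c => (set_nth 0 s r c, o)
  | Add r a b => (set_nth 0 s r (rd a + rd b), o)
  | Sub r a b => (set_nth 0 s r (rd a - rd b), o)
  | LoadAt r a => (set_nth 0 s r (rd (rd a)), o)
  | StoreAt a b => (set_nth 0 s (rd a) (rd b), o)
  | ReadAt r a => (set_nth 0 s r (nth 0 x (rd a)), o)
  | Write a => (s, rcons o (rd a))
  | Seq p q => eval x q (eval x p so)
  | If a p q => if 0 < rd a then eval x p so else eval x q so
  | While _ _ => so
  end.

(** A Hoare triple for total correctness with time bound [K]. Memories are compared pointwise, so
    functional extensionality is avoided. *)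
Definition runs (x : seq nat) (p : program) (so : seq nat * seq nat) (K : nat)
    (Q : seq nat -> seq nat -> Prop) : Prop :=
  forall m : memory, m =1 nth 0 so.1 ->
  exists k m' s o, [/\ k <= K, exec x p m so.2 k m' o, m' =1 nth 0 s & Q s o].

Lemma upd_nth (m : memory) s r v :
  m =1 nth 0 s -> upd m r v =1 nth 0 (set_nth 0 s r v).
Proof. by move=> ms i; rewrite nth_set_nth /upd /= ms. Qed.

Lemma eval_exec x p so (m : memory) : loop_free p -> m =1 nth 0 so.1 ->
  exists k m', [/\ k <= cost p, exec x p m so.2 k m' (eval x p so).2
                 & m' =1 nth 0 (eval x p so).1].
Proof.
elim: p so m => [r c|r a b|r a b|r a|a b|r a|a|p IHp q IHq|a p IHp q IHq|//]
  [s o] m /=.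
- by move=> _ ms; exists 1, (upd m r c); split=> //;
    [apply: ExecConst | apply: upd_nth].
- by move=> _ ms; exists 1, (upd m r (m a + m b)); split=> //;
    [apply: ExecAdd | rewrite !ms; apply: upd_nth].
- by move=> _ ms; exists 1, (upd m r (m a - m b)); split=> //;
    [apply: ExecSub | rewrite !ms; apply: upd_nth].
- by move=> _ ms; exists 1, (upd m r (m (m a))); split=> //;
    [apply: ExecLoad | rewrite !ms; apply: upd_nth].
- by move=> _ ms; exists 1, (upd m (m a) (m b)); split=> //;
    [apply: ExecStore | rewrite !ms; apply: upd_nth].
- by move=> _ ms; exists 1, (upd m r (nth 0 x (m a))); split=> //;
    [apply: ExecRead | rewrite !ms; apply: upd_nth].
- by move=> _ ms; exists 1, m; split=> //; rewrite -ms; apply: ExecWrite.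
- case/andP=> /IHp{}IHp /IHq{}IHq /(IHp (s, o))[k [m1 [le_k run_p]]].
  case/IHq=> l [m2 [le_l run_q ms]]; exists (k + l), m2.
  by split; [apply: leq_add | apply: ExecSeq run_p run_q |].
case/andP=> lfp lfq ms; rewrite -ms; case: posnP => [ma0 | ma_gt0].
  have [k [m1 [le_k run_q m1s]]] := IHq (s, o) m lfq ms; exists k.+1, m1.
  by split=> //; [rewrite ltnS leq_max le_k orbT | apply: ExecIfFalse].
have [k [m1 [le_k run_p m1s]]] := IHp (s, o) m lfp ms; exists k.+1, m1.
by split=> //; [rewrite ltnS leq_max le_k | apply: ExecIfTrue].
Qed.

(** Loop-free code is run symbolically: the postcondition is checked on the computed result of
    [eval]. *)
Lemma runs_eval x p so (Q : seq nat -> seq nat -> Prop) :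
    loop_free p -> Q (eval x p so).1 (eval x p so).2 ->
  runs x p so (cost p) Q.
Proof.
move=> lfp Qeval m /(eval_exec x lfp)[k [m' [le_k run_p ms]]].
by exists k, m', (eval x p so).1, (eval x p so).2.
Qed.

Lemma runs_weaken x p so K L (Q R : seq nat -> seq nat -> Prop) :
    runs x p so K Q -> K <= L -> (forall s o, Q s o -> R s o) ->
  runs x p so L R.
Proof.
move=> run_p le_KL QR m /run_p[k [m' [s [o [le_k run ms Qso]]]]].
by exists k, m', s, o; split=> //; [apply: leq_trans le_KL | apply: QR].
Qed.

Lemma runs_seq x p q so K L (Q R : seq nat -> seq nat -> Prop) :
    runs x p so K Q -> (forall s o, Q s o -> runs x q (s, o) L R) ->
  runs x (Seq p q) so (K + L) R.
Proof.
move=> run_p run_q m /run_p[k [m1 [s [o [le_k run ms Qso]]]]].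
have [l [m2 [s2 [o2 [le_l run2 ms2 Rso]]]]] := run_q s o Qso m1 ms.
by exists (k + l), m2, s2, o2; split; rewrite ?leq_add //; apply: ExecSeq run2.
Qed.

Lemma runs_eval_seq x p q so L (R : seq nat -> seq nat -> Prop) :
    loop_free p -> runs x q (eval x p so) L R ->
  runs x (Seq p q) so (cost p + L) R.
Proof.
move=> lfp run_q; apply: (runs_seq (Q := fun s o => (s, o) = eval x p so)).
  by apply: runs_eval => //; case: (eval _ _ _).
by move=> s o ->.
Qed.

(** The invariant is indexed by the number of iterations left. Each iteration costs its body and one
    test; the final failing test adds one. *)
Lemma runs_while x c p (I : nat -> seq nat -> seq nat -> Prop) K N so :
    (forall s o, I 0 s o -> nth 0 s c = 0) ->
    (forall k s o, k < N -> I k.+1 s o ->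
       0 < nth 0 s c /\ runs x p (s, o) K (I k)) ->
    I N so.1 so.2 ->
  runs x (While c p) so (N * K.+1).+1 (I 0).
Proof.
move=> I0 IS; elim: N so IS => [|N IHN] [s o] IS /= Iso m ms.
  exists 1, m, s, o; split=> //; apply: ExecWhileFalse.
  by rewrite ms (I0 _ _ Iso).
have [c_gt0 run_p] := IS N s o (leqnn _) Iso.
have [k [m1 [s1 [o1 [le_k run1 ms1 I1]]]]] := run_p m ms.
have IS' k' s' o' : k' < N -> I k'.+1 s' o' ->
    0 < nth 0 s' c /\ runs x p (s', o') K (I k').
  by move=> lt_k'; apply: IS; apply: ltnW.
have [l [m2 [s2 [o2 [le_l run2 ms2 I2]]]]] := IHN (s1, o1) IS' I1 m1 ms1.
exists (k + l).+1, m2, s2, o2; split=> //; first by rewrite mulSn; lia.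
by apply: ExecWhileTrue run1 run2; rewrite ms.
Qed.

(** * The program *)

(* Cell 17 is never written, hence contains 0.  [rB] holds the input address of
   the table of indices; [rpx], [rpy] point to the table entries of the current
   vertices x and y, and [rp] to the matrix entry of (x, y); [rc], [rd] count
   the remaining x and y; [rj] is the parameter of the graph being written. *)
Local Notation rzero := 17 (only parsing).
Local Notation rone := 0 (only parsing).
Local Notation rn := 1 (only parsing).
Local Notation rB := 2 (only parsing).
Local Notation rw := 3 (only parsing).
Local Notation rj := 4 (only parsing).
Local Notation rc := 5 (only parsing).
Local Notation rpx := 6 (only parsing).
Local Notation rp := 7 (only parsing).
Local Notation rd := 8 (only parsing).
Local Notation rpy := 9 (only parsing).
Local Notation ra := 10 (only parsing).
Local Notation rlx := 11 (only parsing).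
Local Notation rl := 12 (only parsing).
Local Notation rr := 13 (only parsing).
Local Notation rq := 14 (only parsing).
Local Notation rt := 15 (only parsing).
Local Notation re := 16 (only parsing).

Declare Scope program_scope.
Delimit Scope program_scope with P.
Local Notation "p ;; q" := (Seq p q)
  (at level 90, right associativity) : program_scope.
Local Open Scope program_scope.
Local Notation mov r a := (Add r a rzero).
Local Notation inc r := (Add r r rone).
Local Notation dec r := (Sub r r rone).

(** Writing cell 16 first pads the represented sequence to 17 explicit cells. The loop forms
    [1 + n * n] by repeated addition. *)
Definition setup_prog : program :=
  (Const re 0 ;; Const rone 1 ;; ReadAt rn rzero ;; Const rB 1 ;; mov rc rn) ;;
  While rc (Add rB rB rn ;; dec rc).

(** With [d] the distance of the two indices, [rt] ends as [d - w], and adding it to [rw] yields the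
    maximum of [w] and [d]. *)
Definition width_cell : program :=
  (ReadAt rr rpy ;; ReadAt re rp) ;;
  If re (Sub rt ra rr ;; Sub rq rr ra ;; Add rt rt rq ;; Sub rt rt rw ;;
         Add rw rw rt)
        (Const rt 0).

Definition next_row : program := inc rpx ;; dec rc.
Definition next_col : program := inc rp ;; inc rpy ;; dec rd.

Definition width_prog : program :=
  (Const rp 1 ;; mov rc rn ;; mov rpx rB) ;;
  While rc ((ReadAt ra rpx ;; mov rpy rB ;; mov rd rn) ;;
            While rd (width_cell ;; next_col) ;;
            next_row).

(** The loop test [r + 1 - w] is positive iff [r >= w]. At the end, [1 - (j - r)] is the truth value
    of [j <= r]. *)
Definition level_prog : program :=
  (mov rr ra ;; Const rq 0 ;; Add rt rr rone ;; Sub rt rt rw) ;;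
  While rt (Sub rr rr rw ;; inc rq ;; Add rt rr rone ;; Sub rt rt rw) ;;
  If rj (Sub rl rj rr ;; Sub rl rone rl) (mov rl rq).

(* In truncated arithmetic [1 - d] is the truth value of [d = 0]; the bit written
   is [1 - (1 - ((1 - |lx - l|) + G x y)) - (1 - |px - py|)]. *)
Definition same_level : program :=
  ReadAt re rp ;; Sub rt rlx rl ;; Sub rq rl rlx ;; Add rt rt rq ;;
  Sub rt rone rt.

Definition same_vertex : program :=
  Add re re rt ;; Sub re rone re ;; Sub rt rpx rpy ;;
  Sub rq rpy rpx ;; Add rt rt rq ;; Sub rt rone rt.

Definition write_bit : program :=
  Sub rq rone re ;; Sub rt rq rt ;; Write rt.

Definition matrix_prog : program :=
  (Const rp 1 ;; mov rc rn ;; mov rpx rB) ;;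
  While rc (ReadAt ra rpx ;; level_prog ;;
            (mov rlx rl ;; mov rpy rB ;; mov rd rn) ;;
            While rd (ReadAt ra rpy ;; level_prog ;;
                      same_level ;; same_vertex ;; write_bit ;; next_col) ;;
            next_row).

Definition decomposition_prog : program :=
  setup_prog ;; width_prog ;; mov rj rw ;; While rj (dec rj ;; matrix_prog).

(** * Correctness and cost of the program *)

Section Correctness.

Variables (x : seq nat) (n : nat) (g : nat -> nat -> bool) (ix : nat -> nat).

Hypothesis x_size : nth 0 x 0 = n.
Hypothesis x_edge : forall i j, i < n -> j < n -> nth 0 x (1 + i * n + j) = g i j.
Hypothesis x_index : forall i, i < n -> nth 0 x (1 + n * n + i) = ix i.
Hypothesis ix_lt : forall i, i < n -> ix i < n.

Local Notation B := (1 + n * n).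

Definition input_width : nat :=
  \max_(i <- iota 0 n) \max_(j <- iota 0 n | g i j) `|ix i - ix j|%N.

Lemma setup_prog_runs : runs x setup_prog ([::], [::]) (5 + (n * 3).+1)
  (fun s o => s = [:: 1; n; B; 0; 0; 0; 0; 0; 0; 0; 0; 0; 0; 0; 0; 0; 0]
              /\ o = [::]).
Proof.
apply: runs_eval_seq => //=; rewrite x_size.
apply: (runs_weaken (runs_while (K := 2) (N := n) (I := fun k s o =>
  s = [:: 1; n; 1 + n * (n - k); 0; 0; k; 0; 0; 0; 0; 0; 0; 0; 0; 0; 0; 0]
  /\ k <= n /\ o = [::]) _ _ _)) => //=.
- by move=> s o [-> _].
- move=> k s o lt_kn [-> [_ ->]]; split=> //.
  apply: runs_eval => //=; split; last by split=> //; apply: ltnW.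
  by congr [:: _, _, _, _, _, _ & _]; nia.
- by rewrite subnn muln0 !addn0.
- by move=> s o [-> [_ ->]]; rewrite subn0.
Qed.

Definition width_row_cost := cost (Seq width_cell next_col).

Lemma width_row_runs i w c r q t e : i < n ->
  runs x (While rd (width_cell ;; next_col))
    ([:: 1; n; B; w; 0; c; B + i; 1 + i * n; n; B; ix i; 0; 0; r; q; t; e], [::])
    (n * width_row_cost.+1).+1
    (fun s o => (exists r q t e, s =
       [:: 1; n; B; maxn w (\max_(j <- iota 0 n | g i j) `|ix i - ix j|%N); 0; c;
           B + i; 1 + i.+1 * n; 0; B + n; ix i; 0; 0; r; q; t; e])
       /\ o = [::]).
Proof.
move=> lt_in; set M := maxn w _.
(* The current maximum, combined with the columns still to be read, always gives [M]. *)
apply: (runs_weaken (runs_while (K := width_row_cost) (N := n) (I := fun k s o =>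
  (exists v r q t e, s = [:: 1; n; B; v; 0; c; B + i; 1 + i * n + (n - k); k;
                             B + (n - k); ix i; 0; 0; r; q; t; e]
     /\ maxn v (\max_(j <- iota (n - k) k | g i j) `|ix i - ix j|%N) = M)
  /\ o = [::]) _ _ _)) => //=.
- by move=> s o [[? [? [? [? [? [-> _]]]]]]].
- move=> k s o lt_kn [[v [r0 [q0 [t0 [e0 [-> eqM]]]]]] ->]; split=> //.
  have lt_y : n - k.+1 < n by lia.
  have Ek : n - k = (n - k.+1).+1 by lia.
  apply: runs_eval => //=.
  rewrite x_edge // x_index // lt0b.
  move: eqM; rewrite /= big_cons -Ek distn_subD.
  case: (g i (n - k.+1)) => /= eqM; split=> //.
    exists (maxn v (ix i - ix (n - k.+1) + (ix (n - k.+1) - ix i))).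
    do 4 eexists; split; last by rewrite -maxnA.
    (* [maxnE] is the truncated formula for the maximum that [width_cell] evaluates. *)
    by congr [:: _, _, _, _, _, _, _, _, _, _ & _]; rewrite ?maxnE; lia.
  exists v; do 4 eexists; split; last exact: eqM.
  by congr [:: _, _, _, _, _, _, _, _, _, _ & _]; lia.
- by split=> //; exists w, r, q, t, e; rewrite subnn !addn0.
- move=> s o [[v [r0 [q0 [t0 [e0 [-> eqM]]]]]] ->]; split=> //.
  do 4 eexists; rewrite -eqM /= big_nil maxn0.
  by congr [:: _, _, _, _, _, _, _, _, _, _ & _]; nia.
Qed.

Definition width_cost := 3 + (n * (3 + ((n * width_row_cost.+1).+1 + 2)).+1).+1.

Lemma width_prog_runs :
  runs x width_prog
    ([:: 1; n; B; 0; 0; 0; 0; 0; 0; 0; 0; 0; 0; 0; 0; 0; 0], [::]) width_cost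
    (fun s o => (exists c px p d py a r q t e, s =
       [:: 1; n; B; input_width; 0; c; px; p; d; py; a; 0; 0; r; q; t; e])
       /\ o = [::]).
Proof.
apply: runs_eval_seq => //=; rewrite !addn0.
apply: (runs_weaken (runs_while (K := 3 + ((n * width_row_cost.+1).+1 + 2))
  (N := n) (I := fun k s o =>
  (exists v d py a r q t e, s = [:: 1; n; B; v; 0; k; B + (n - k);
      1 + (n - k) * n; d; py; a; 0; 0; r; q; t; e]
   /\ maxn v (\max_(i <- iota (n - k) k)
        \max_(j <- iota 0 n | g i j) `|ix i - ix j|%N) = input_width)
  /\ o = [::]) _ _ _)) => //=.
- by move=> s o [[? [? [? [? [? [? [? [? [-> _]]]]]]]]]].
- move=> k s o lt_kn [[v [d [py [a [r [q [t [e [-> eqM]]]]]]]]] ->]; split=> //.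
  have lt_y : n - k.+1 < n by lia.
  have Ek : n - k = (n - k.+1).+1 by lia.
  apply: runs_eval_seq => //=; rewrite !addn0 x_index //.
  apply: (runs_seq (width_row_runs lt_y)) => // s1 o1.
  case=> [[r1 [q1 [t1 [e1 ->]]]] ->].
  apply: runs_eval => //=; split=> //.
  exists (maxn v (\max_(j <- iota 0 n | g (n - k.+1) j)
                   `|ix (n - k.+1) - ix j|%N)).
  do 7 eexists; split; last by rewrite -eqM /= big_cons -Ek maxnA.
  by congr [:: _, _, _, _, _, _, _, _ & _]; nia.
- by rewrite subnn addn0; split=> //; exists 0; do 7 eexists; rewrite max0n.
- move=> s o [[v [d [py [a [r [q [t [e [-> eqM]]]]]]]]] ->]; split=> //.
  by do 10 eexists; rewrite -eqM /= big_nil maxn0.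
Qed.

Definition level_cost := 4 + ((n * 5).+1 + 3).

Lemma level_prog_runs w j c px p d py a lx l r q t e o : 0 < w -> a < n ->
  runs x level_prog
    ([:: 1; n; B; w; j; c; px; p; d; py; a; lx; l; r; q; t; e], o) level_cost
    (fun s o' => s = [:: 1; n; B; w; j; c; px; p; d; py; a; lx; level w j a;
                         a %% w; a %/ w; 0; e] /\ o' = o).
Proof.
move=> w_gt0 lt_an; apply: runs_eval_seq => //=; rewrite addn0.
(* With [k] subtractions left, the remainder cell exceeds [a %% w] by [k * w], and the tested cell
   is positive exactly when [k > 0]. *)
pose I k (s o' : seq nat) := s =
  [:: 1; n; B; w; j; c; px; p; d; py; a; lx; l; a %% w + k * w; a %/ w - k;
      (a %% w + k * w + 1) - w; e] /\ o' = o.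
apply: (runs_seq (Q := I 0)); last first.
  move=> s o' [-> ->]; apply: runs_eval; first by [].
  have lt_r := ltn_pmod a w_gt0.
  rewrite /= /level mul0n addn0 subn0; split; last by case: posnP.
  case: posnP => j0 /=; rewrite ?j0 ?addn0.
    by congr [:: _, _, _, _, _, _, _, _, _, _, _, _, _, _, _, _ & _]; lia.
  by congr [:: _, _, _, _, _, _, _, _, _, _, _, _, _, _, _, _ & _]; lia.
apply: (runs_weaken (runs_while (K := 4) (N := a %/ w) (I := I) _ _ _)) => //=.
- by move=> s o' [-> _] /=; have := ltn_pmod a w_gt0; lia.
- move=> k s o' lt_k [-> ->]; split; first by rewrite /=; nia.
  apply: runs_eval => //=; split=> //.
  by congr [:: _, _, _, _, _, _, _, _, _, _, _, _, _, _, _, _ & _]; nia.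
- by split=> //; rewrite [_ %% _ + _]addnC -divn_eq subnn.
(* The quotient is at most [a], hence at most [n]; so the cost does not depend on [w]. *)
- by rewrite ltnS leq_mul2r (leq_trans (leq_div _ _) (ltnW lt_an)).
Qed.

Definition bit w j i y : bool :=
  (i != y) && (g i y || (level w j (ix i) == level w j (ix y))).

Definition matrix_row_cost := 1 + (level_cost + (5 + (6 + (3 + 3)))).

Lemma matrix_row_runs w j i c l r q t e o : 0 < w -> i < n ->
  runs x (While rd (ReadAt ra rpy ;; level_prog ;;
                      same_level ;; same_vertex ;; write_bit ;; next_col))
    ([:: 1; n; B; w; j; c; B + i; 1 + i * n; n; B; ix i; level w j (ix i);
         l; r; q; t; e], o)
    (n * matrix_row_cost.+1).+1
    (fun s o' => (exists a l r q t e, s =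
       [:: 1; n; B; w; j; c; B + i; 1 + i.+1 * n; 0; B + n; a; level w j (ix i);
         l; r; q; t; e])
       /\ o' = o ++ [seq nat_of_bool (bit w j i y) | y <- iota 0 n]).
Proof.
move=> w_gt0 lt_in; set O := o ++ _.
(* The output so far, followed by the bits still due, is always [O]. *)
apply: (runs_weaken (runs_while (K := matrix_row_cost) (N := n) (I := fun k s o =>
  (exists a l r q t e, s = [:: 1; n; B; w; j; c; B + i; 1 + i * n + (n - k); k;
      B + (n - k); a; level w j (ix i); l; r; q; t; e])
  /\ o ++ [seq nat_of_bool (bit w j i y) | y <- iota (n - k) k] = O) _ _ _)) => //=.
- by move=> s o' [[? [? [? [? [? [? ->]]]]]]].
- move=> k s o' lt_kn [[a [l1 [r1 [q1 [t1 [e1 ->]]]]]] eqO]; split=> //.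
  have lt_y : n - k.+1 < n by lia.
  have Ek : n - k = (n - k.+1).+1 by lia.
  apply: runs_eval_seq => //=; rewrite x_index //.
  apply: (runs_seq (level_prog_runs w_gt0 (ix_lt lt_y))).
  move=> s1 o1 [-> ->]; apply: runs_eval_seq => //=; rewrite x_edge //.
  do 2 apply: runs_eval_seq => //=; apply: runs_eval => //=; split.
    by do 6 eexists; congr [:: _, _, _, _, _, _, _, _, _, _ & _]; lia.
  rewrite -eqO /= -Ek -cat_rcons; congr (rcons _ _ ++ _).
  (* The pointers to the two table entries differ as the vertex numbers do, so their truncated
     differences decide whether the vertices coincide. *)
  rewrite /bit; case: (g i _); case: eqP => ?; case: eqP => ?; rewrite /=; lia.
- by rewrite subnn !addn0; split=> //; exists (ix i), l, r, q, t, e.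
- move=> s o' [[a [l1 [r1 [q1 [t1 [e1 ->]]]]]] <-]; rewrite cats0; split=> //.
  by do 6 eexists; congr [:: _, _, _, _, _, _, _, _, _, _ & _]; nia.
Qed.

Definition output_matrix w j : seq nat :=
  flatten [seq [seq nat_of_bool (bit w j i y) | y <- iota 0 n] | i <- iota 0 n].

Definition matrix_body_cost :=
  1 + (level_cost + (3 + ((n * matrix_row_cost.+1).+1 + 2))).

Definition matrix_cost := 3 + (n * matrix_body_cost.+1).+1.

Lemma matrix_prog_runs w j c px p d py a lx l r q t e o : 0 < w ->
  runs x matrix_prog
    ([:: 1; n; B; w; j; c; px; p; d; py; a; lx; l; r; q; t; e], o) matrix_cost
    (fun s o' => (exists c px p d py a lx l r q t e, s =
       [:: 1; n; B; w; j; c; px; p; d; py; a; lx; l; r; q; t; e])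
       /\ o' = o ++ output_matrix w j).
Proof.
move=> w_gt0; apply: runs_eval_seq => //=; rewrite !addn0; set O := o ++ _.
apply: (runs_weaken (runs_while (K := matrix_body_cost)
  (N := n) (I := fun k s o =>
  (exists d py a lx l r q t e, s = [:: 1; n; B; w; j; k; B + (n - k);
      1 + (n - k) * n; d; py; a; lx; l; r; q; t; e])
  /\ o ++ flatten [seq [seq nat_of_bool (bit w j i y) | y <- iota 0 n]
                  | i <- iota (n - k) k] = O) _ _ _)) => //=.
- by move=> s o' [[? [? [? [? [? [? [? [? [? ->]]]]]]]]]].
- move=> {d py a lx l r q t e} k s o' lt_kn
    [[d [py [a [lx [l [r [q [t [e ->]]]]]]]]] eqO]; split=> //.
  have lt_y : n - k.+1 < n by lia.
  have Ek : n - k = (n - k.+1).+1 by lia.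
  apply: runs_eval_seq => //=; rewrite x_index //.
  apply: (runs_seq (level_prog_runs w_gt0 (ix_lt lt_y))).
  move=> s1 o1 [-> ->]; apply: runs_eval_seq => //=; rewrite !addn0.
  apply: (runs_seq (matrix_row_runs w_gt0 lt_y)) => s2 o2.
  case=> [[a2 [l2 [r2 [q2 [t2 [e2 ->]]]]]] ->].
  apply: runs_eval => //=; split; last by rewrite -eqO /= -Ek catA.
  by do 9 eexists; congr [:: _, _, _, _, _, _, _, _ & _]; nia.
- by rewrite subnn addn0; split=> //; do 9 eexists.
- move=> s o' [E <-]; rewrite cats0; split=> //.
  case: E => [d1 [py1 [a1 [lx1 [l1 [r1 [q1 [t1 [e1 ->]]]]]]]]].
  by do 12 eexists.
Qed.

Definition total_cost w :=
  (5 + (n * 3).+1) + (width_cost + (1 + (w * (1 + matrix_cost).+1).+1)).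

(** [rj] is decremented before each matrix is written, so the parameter runs from [input_width - 1]
    down to 0. *)
Lemma decomposition_prog_runs : 0 < input_width ->
  runs x decomposition_prog ([::], [::]) (total_cost input_width)
    (fun s o =>
       o = flatten [seq output_matrix input_width (input_width - i.+1)
                   | i <- iota 0 input_width]).
Proof.
move=> w_gt0; apply: (runs_seq setup_prog_runs) => s o [-> ->] {s o}.
apply: (runs_seq width_prog_runs) => s o.
case=> [[c [px [p [d [py [a [r [q [t [e ->]]]]]]]]]] ->].
move=> {s o}; apply: (runs_eval_seq (p := mov rj rw)) => //=; rewrite addn0.
set w := input_width in w_gt0 *; set O := flatten _.
apply: (runs_weaken (runs_while (K := 1 + matrix_cost) (N := w) (I := fun k s o =>
  (exists c px p d py a lx l r q t e, s =
       [:: 1; n; B; w; k; c; px; p; d; py; a; lx; l; r; q; t; e])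
  /\ o ++ flatten [seq output_matrix w (w - i.+1) | i <- iota (w - k) k] = O)
  _ _ _)) => //=.
- by move=> s o' [[? [? [? [? [? [? [? [? [? [? [? [? ->]]]]]]]]]]]]].
- move=> {c px p d py a r q t e} k s o lt_kw.
  case=> [[c [px [p [d [py [a [lx [l [r [q [t [e ->]]]]]]]]]]]] eqO]; split=> //.
  apply: runs_eval_seq => //=.
  apply: (runs_weaken (matrix_prog_runs w_gt0)) => //.
  have Ek : (w - k.+1).+1 = w - k by lia.
  have Ej : w - (w - k) = k by lia.
  rewrite Ek Ej in eqO; rewrite subn1 /= => s1 o1 [E ->].
  by rewrite -catA; split.
- by split; [do 12 eexists | rewrite subnn].
- by move=> s o [_ <-]; rewrite cats0.
Qed.

End Correctness.

(** * Encodings and running time *)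

(** The cost increases with [w], and for [w = n] it is [5n^4 + 32n^3 + 28n^2 + 16n + 12], so the
    constant 100 is generous. *)
Lemma total_cost_leq n w N : w <= n -> n < N -> total_cost n w <= 100 * N ^ 4.
Proof.
move=> le_wn lt_nN; apply: leq_trans (_ : 100 * n.+1 ^ 4 <= _); last first.
  by rewrite leq_mul2l leq_exp2r.
apply: (@leq_trans (total_cost n n)).
  by rewrite /total_cost !leq_add2l ltnS leq_mul2r le_wn orbT.
rewrite /total_cost /width_cost /matrix_cost /matrix_body_cost /matrix_row_cost.
rewrite /level_cost /width_row_cost /= !expnS expn0.
nia.
Qed.

Lemma nth_flatten_map2 (S T : Type) (a0 : S) (b0 : T) (F : S -> T -> nat)
    s t i j :
    i < size s -> j < size t ->
  nth 0 (flatten [seq [seq F a b | b <- t] | a <- s]) (i * size t + j) =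
    F (nth a0 s i) (nth b0 t j).
Proof.
move=> + lt_j; elim: s i => // a s IHs [|i] /= lt_i; rewrite nth_cat size_map.
  by rewrite mul0n lt_j (nth_map b0).
rewrite ltnNge mulSn -addnA leq_addr /= addKn; exact: IHs.
Qed.

Section Encoding.

Variables (V : finType) (G : sgraph V) (t : nat) (C : t.+1.-tuple {set V}).
Variable v0 : V.

Let n := #|V|.
Let vx i := nth v0 (enum V) i.
Let g i j := G (vx i) (vx j).
Let ix i := cover_index C (vx i).

Lemma enum_nth : enum V = [seq vx i | i <- iota 0 n].
Proof. by rewrite -[LHS](mkseq_nth v0) -cardE. Qed.

Lemma encode_input_size : nth 0 (encode_input G C) 0 = n.
Proof. by []. Qed.

Lemma encode_input_edge i j : i < n -> j < n ->
  nth 0 (encode_input G C) (1 + i * n + j) = g i j.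
Proof.
move=> lt_i lt_j; rewrite /encode_input -addnA add1n /= nth_cat.
rewrite size_allpairs -cardE -/n.
have -> : i * n + j < n * n by nia.
rewrite /encode_graph [n in i * n]cardE.
by rewrite (nth_flatten_map2 v0 v0) -?cardE.
Qed.

Lemma encode_input_index i : i < n ->
  nth 0 (encode_input G C) (1 + n * n + i) = ix i.
Proof.
move=> lt_i; rewrite /encode_input -addnA add1n /= nth_cat.
rewrite size_allpairs -cardE -/n ltnNge leq_addr /= addKn.
by rewrite (nth_map v0) // -cardE.
Qed.

Lemma input_width_encode :
  ordered_clique_cover G C -> input_width n g ix = width G C.
Proof.
move=> coverC.
have bigE (P : pred V) (F : V -> nat) :
    \max_(x | P x) F x = \max_(i <- iota 0 n | P (vx i)) F (vx i).
  rewrite -(big_map vx P F) -enum_nth big_enum_cond /=.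
  by apply: eq_bigl.
by rewrite (widthE coverC) bigE; apply: eq_bigr => i _; rewrite bigE.
Qed.

(** Comparing numbers amounts to comparing vertices, as [enum V] has no repetitions. *)
Lemma matrix_encode j :
  output_matrix n g ix (width G C) j = encode_graph (component G C j).
Proof.
rewrite /output_matrix /encode_graph enum_nth -map_comp; congr flatten.
apply/eq_in_map => i; rewrite mem_iota => lt_i /=; rewrite -map_comp.
apply/eq_in_map => k; rewrite mem_iota => lt_k /=.
by rewrite /bit /merge_edge nth_uniq ?enum_uniq -?cardE.
Qed.

Lemma size_encode_input : n < size (encode_input G C).
Proof. by rewrite /encode_input /= ltnS size_cat size_map -cardE leq_addl. Qed.

End Encoding.

Theorem theorem2p1 :
  exists (A : program) (f : {poly nat}),
  forall (V : finType) (G : sgraph V) (t : nat) (C : t.+1.-tuple {set V}),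
    ordered_clique_cover G C -> 0 < width G C ->
    exists H : 'I_(width G C) -> sgraph V,
      [/\ forall i, unit_incomparability (H i),
          forall x y, G x y = [forall i, H i x y],
          forall i : 'I_(width G C), i.+1 < width G C -> cobipartite (H i) &
          computes_within A f (encode_input G C) (encode_graphs H)].
Proof.
exists decomposition_prog, (100 *: 'X^4)%R => V G t C coverC w_gt0.
(* Component j = 0, of the quotients, comes last, as the loop counts j down. *)
exists (fun i => component G C (width G C - i.+1)); split.
- by move=> i; apply: component_unit.
- exact: bigcap_component.
- by move=> i lt_i; apply: component_cobipartite; rewrite subn_gt0.
(* The vertex [v0] serves as the default value of [nth] in the numbering of the vertices. *)
have /card_gt0P[v0 _] : 0 < #|V| := leq_trans (ltn0Sn t) (cover_size coverC).
have ix_lt i : i < #|V| -> cover_index C (nth v0 (enum V) i) < #|V|.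
  by move=> _; apply: leq_trans (cover_index_lt coverC _) (cover_size coverC).
have w_eq := input_width_encode v0 coverC.
have := decomposition_prog_runs (encode_input_size G C)
  (encode_input_edge G C v0) (encode_input_index G C v0) ix_lt.
(* The initial zero memory is represented by the empty sequence. *)
rewrite w_eq => /(_ w_gt0 (fun=> 0)) [|k [m [s [o [le_k run _ def_o]]]]].
  by case.
exists k.
  rewrite hornerZ hornerXn !natrE; apply: (leq_trans le_k).
  apply: total_cost_leq.
    exact: leq_trans (width_leq G C) (ltnW (cover_size coverC)).
  exact: size_encode_input.
exists m; move: run; rewrite def_o; congr exec.
rewrite /encode_graphs -val_enum_ord -map_comp; congr flatten.
by apply: eq_map => i /=; rewrite matrix_encode.
Qed.
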